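(* For every integer $k\ge 2$, $F_{k\cdots 21}(x,y)=F_{12\cdots k}(x,y)$, and $F=F_{12\cdots k}(x,y)$ satisfies $$F=\sum_{n=0}^{k-2}x^nF^n+\frac{x^{k-1}F^{k-1}}{1-xyF}.$$
   Context: The patterns $12\cdots k$ and $k\cdots 21$ are written without dashes, so an occurrence of $12\cdots k$ (resp. $k\cdots21$) in $\pi=\pi_1\cdots\pi_n\in S_n$ is a position $i$ with $\pi_i<\pi_{i+1}<\dots<\pi_{i+k-1}$ (resp. $\pi_i>\pi_{i+1}>\dots>\pi_{i+k-1}$). A permutation is $1\text{-}3\text{-}2$-avoiding if there are no positions $a<b<c$ with $\pi_a<\pi_c<\pi_b$. For a pattern $\tau$, $f_{\tau;r}(n)$ is the number of $1\text{-}3\text{-}2$-avoiding permutations in $S_n$ containing exactly $r$ occurrences of $\tau$ (with $S_0$ consisting of the empty permutation), and $F_\tau(x,y)=\sum_{n,r\ge 0} f_{\tau;r}(n)x^ny^r$, viewed as a formal power series in $x$ with coefficients in $\mathbb Z[y]$. *)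

(* Defs.v *)
From HB Require Import structures.
From mathcomp Require Import all_boot all_order all_algebra all_fingroup.
From mathcomp Require Import boolp.

Set Implicit Arguments.
Unset Strict Implicit.
Unset Printing Implicit Defensive.

Import GRing.Theory.
Local Open Scope ring_scope.

(* The series with coefficients c_0, c_1, ... is [Fps c].  Equality is Leibniz
   equality, i.e. equality of all coefficients (lemma [fpsP]). *)
Record fps (R : Type) : Type := Fps { fcoef : nat -> R }.

HB.instance Definition _ (R : Type) := gen_eqMixin (fps R).
HB.instance Definition _ (R : Type) := gen_choiceMixin (fps R).

Lemma fpsP (R : Type) (f g : fps R) : f = g <-> (forall n, fcoef f n = fcoef g n).
Proof.
split=> [-> //|]; case: f g => [f] [g] /= fg.
by congr Fps; apply: funext.
Qed.

Section FpsRing.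
Variable R : comNzRingType.
Implicit Types f g h : fps R.

Definition fps_zero : fps R := Fps (fun _ => 0).
Definition fps_opp f : fps R := Fps (fun n => - fcoef f n).
Definition fps_add f g : fps R := Fps (fun n => fcoef f n + fcoef g n).
Definition fpsC (c : R) : fps R := Fps (fun n => if n is 0 then c else 0).
Definition fps_mul f g : fps R :=
  Fps (fun n => \sum_(i < n.+1) fcoef f i * fcoef g (n - i)).
Definition fpsX : fps R := Fps (fun n => (n == 1%N)%:R).

Fact fps_addA : associative fps_add.
Proof. by move=> f g h; apply/fpsP => n /=; rewrite addrA. Qed.
Fact fps_addC : commutative fps_add.
Proof. by move=> f g; apply/fpsP => n /=; rewrite addrC. Qed.
Fact fps_add0 : left_id fps_zero fps_add.
Proof. by move=> f; apply/fpsP => n /=; rewrite add0r. Qed.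
Fact fps_addN : left_inverse fps_zero fps_opp fps_add.
Proof. by move=> f; apply/fpsP => n /=; rewrite addNr. Qed.

HB.instance Definition _ :=
  GRing.isZmodule.Build (fps R) fps_addA fps_addC fps_add0 fps_addN.

Let trunc N f : {poly R} := \poly_(i < N) fcoef f i.

Let mul_trunc N f g n : (n < N)%N ->
  fcoef (fps_mul f g) n = (trunc N f * trunc N g)`_n.
Proof.
move=> nN; rewrite coefM /=; apply: eq_bigr => i _.
rewrite !coef_poly (leq_ltn_trans (leq_subr _ _) nN).
by rewrite (leq_ltn_trans _ nN) // -ltnS.
Qed.

Fact fps_mulC : commutative fps_mul.
Proof.
by move=> f g; apply/fpsP => n; rewrite !(mul_trunc _ _ (ltnSn n)) mulrC.
Qed.

Fact fps_mulA : associative fps_mul.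
Proof.
have mul3 f g h n : fcoef (fps_mul (fps_mul f g) h) n =
    (trunc n.+1 f * trunc n.+1 g * trunc n.+1 h)`_n.
  rewrite [RHS]coefM /=; apply: eq_bigr => i _.
  by rewrite -(mul_trunc _ _ (ltn_ord i)) coef_poly ltnS leq_subr.
move=> f g h; apply/fpsP => n; rewrite [fps_mul f _]fps_mulC !mul3.
by congr (polyseq _)`_n; rewrite mulrC mulrA.
Qed.

Fact fps_mul1 : left_id (fpsC 1) fps_mul.
Proof.
move=> f; apply/fpsP => n /=; rewrite big_ord_recl /= mul1r subn0.
by rewrite big1 ?addr0 // => i _; rewrite mul0r.
Qed.

Fact fps_mulDl : left_distributive fps_mul fps_add.
Proof.
move=> f g h; apply/fpsP => n /=; rewrite -big_split /=.
by apply: eq_bigr => i _; rewrite mulrDl.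
Qed.

Fact fps_1neq0 : fpsC 1 != fps_zero.
Proof.
by apply/eqP => /fpsP /(_ 0%N) /= /eqP; rewrite oner_eq0.
Qed.

HB.instance Definition _ := GRing.Zmodule_isComNzRing.Build (fps R)
  fps_mulA fps_mulC fps_mul1 fps_mulDl fps_1neq0.

Lemma fcoef0 n : fcoef (0 : fps R) n = 0. Proof. by []. Qed.
Lemma fcoef1 n : fcoef (1 : fps R) n = (n == 0%N)%:R.
Proof. by case: n. Qed.
Lemma fcoefD f g n : fcoef (f + g) n = fcoef f n + fcoef g n.
Proof. by []. Qed.
Lemma fcoefN f n : fcoef (- f) n = - fcoef f n. Proof. by []. Qed.
Lemma fcoefM f g n :
  fcoef (f * g) n = \sum_(i < n.+1) fcoef f i * fcoef g (n - i).
Proof. by []. Qed.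

End FpsRing.

Section FpsUnitRing.
Variable R : comUnitRingType.
Implicit Types f g : fps R.

Definition fps_unit : {pred fps R} := [pred f | fcoef f 0 \is a GRing.unit].

(* The first n coefficients of the inverse of f, by solving f * g = 1
   coefficient by coefficient. *)
Fixpoint fps_inv_seq f (n : nat) : seq R :=
  if n is m.+1 then
    let s := fps_inv_seq f m in
    rcons s ((fcoef f 0)^-1 *
             ((m == 0%N)%:R - \sum_(i < m) s`_i * fcoef f (m - i)))
  else [::].

Definition fps_inv f : fps R :=
  if f \in fps_unit then Fps (fun n => (fps_inv_seq f n.+1)`_n) else f.

Let size_inv_seq f n : size (fps_inv_seq f n) = n.
Proof. by elim: n => //= n IHn; rewrite size_rcons IHn. Qed.

Let nth_inv_seq f n i : (i < n)%N ->
  (fps_inv_seq f n)`_i = (fps_inv_seq f i.+1)`_i.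
Proof.
elim: n => // n IHn; rewrite ltnS leq_eqVlt => /predU1P[-> //|lt_in].
by rewrite [LHS]/= nth_rcons size_inv_seq lt_in IHn.
Qed.

Fact fps_mulVf : {in fps_unit, left_inverse 1 fps_inv *%R}.
Proof.
move=> f uf; apply/fpsP => n; rewrite fcoef1 fcoefM /fps_inv uf.
rewrite big_ord_recr /= nth_rcons size_inv_seq ltnn eqxx subnn.
rewrite [_ * fcoef f 0]mulrC mulVKr // addrC -[RHS]subr0 -addrA; congr (_ + _).
apply/eqP; rewrite oppr0 addrC subr_eq0; apply/eqP/eq_bigr => i _.
by rewrite (nth_inv_seq f (ltn_ord i)).
Qed.

Fact fps_unitP f g : g * f = 1 -> f \in fps_unit.
Proof.
move=> /fpsP /(_ 0%N); rewrite fcoef1 fcoefM big_ord1 /= => gf1.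
by apply/unitrPr; exists (fcoef g 0); rewrite mulrC.
Qed.

Fact fps_inv_out : {in [predC fps_unit], fps_inv =1 id}.
Proof. by move=> f /negPf uf; rewrite /fps_inv uf. Qed.

HB.instance Definition _ := GRing.ComNzRing_hasMulInverse.Build (fps R)
  fps_mulVf fps_unitP fps_inv_out.

Lemma fps_unitE f : (f \is a GRing.unit) = (fcoef f 0 \is a GRing.unit).
Proof. by []. Qed.

End FpsUnitRing.

Local Open Scope nat_scope.

(* The one-line notation pi_1 ... pi_n, with both positions and values
   shifted to range over {0, ..., n-1}. *)
Definition word n (pi : 'S_n) : seq nat := [seq val (pi i) | i <- enum 'I_n].

Definition avoids132 n (pi : 'S_n) : bool :=
  ~~ [exists a : 'I_n, exists b : 'I_n, exists c : 'I_n,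
        [&& a < b, b < c, pi a < pi c & pi c < pi b]].

(* Number of positions i such that pi_i, ..., pi_(i+k-1) all exist and each of
   them is [lt]-related to the next: [lt := ltn] gives the dashless pattern
   12...k, and [lt := gtn] the dashless pattern k...21. *)
Definition occ (lt : rel nat) (k n : nat) (pi : 'S_n) : nat :=
  #|[set i : 'I_n | (i + k <= n) && sorted lt (take k (drop i (word pi)))]|.

(* f_{tau;r}(n) *)
Definition count132 (lt : rel nat) (k r n : nat) : nat :=
  #|[set pi : 'S_n | avoids132 pi && (occ lt k pi == r)]|.

Lemma occ_le lt k n (pi : 'S_n) : occ lt k pi <= n.
Proof. by rewrite -[leqRHS]card_ord max_card. Qed.

(* Only r <= n contributes to the coefficient of x^n, so that this coefficient
   is a polynomial in y. *)
Lemma count132_eq0 lt k r n : n < r -> count132 lt k r n = 0.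
Proof.
move=> lt_nr; apply: eq_card0 => pi; rewrite inE.
by rewrite (ltn_eqF (leq_ltn_trans (occ_le lt k pi) lt_nr)) andbF.
Qed.

Local Open Scope ring_scope.

(* F_tau(x, y), an element of Z[y][[x]] *)
Definition genfun132 (lt : rel nat) (k : nat) : fps {poly int} :=
  Fps (fun n => \poly_(r < n.+1) (count132 lt k r n)%:R).

Lemma coef_genfun132 lt k n r :
  (fcoef (genfun132 lt k) n)`_r = (count132 lt k r n)%:R.
Proof. by rewrite coef_poly ltnS; case: leqP => // /count132_eq0 ->. Qed.

Definition F_inc (k : nat) : fps {poly int} := genfun132 ltn k.
Definition F_dec (k : nat) : fps {poly int} := genfun132 gtn k.

Definition x_var : fps {poly int} := fpsX {poly int}.
Definition y_var : fps {poly int} := fpsC 'X.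

(* The denominator occurring in the functional equation is invertible, so
   division by it is genuine division of power series. *)
Lemma unit_1BxyF (F : fps {poly int}) :
  1 - x_var * y_var * F \is a GRing.unit.
Proof.
rewrite fps_unitE fcoefD fcoefN fcoef1 !fcoefM big_ord1 fcoefM big_ord1 /=.
by rewrite !mul0r subr0 unitr1.
Qed.

(* Main.v *)
(* A 1-3-2-avoiding permutation is [l m r] with [m] its maximum, every entry of
   [l] larger than every entry of [r], and [l], [r] again 1-3-2-avoiding; so these
   permutations are encoded by binary trees.  A decreasing run through [m] is
   [m] followed by the first decreasing run of [r], an increasing one is the last
   increasing run of [l] followed by [m]: mirroring the tree exchanges the two
   statistics.  With [E] the series in which a tree also pays [y] if putting an
   entry in front of its first run completes an occurrence, this gives
   [F = 1 + x F E].  If [D_m] counts the trees with first run of length [m], then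
   [D_m (1 - x E) = x y^[m >= k] D_(m-1)], and since [F (1 - x E) = 1] this is
   [D_m = x F y^[m >= k] D_(m-1)]; summing over [m] gives the equation. *)
From HB Require Import structures.
Require Import Defs.
From mathcomp Require Import all_boot all_order all_algebra all_fingroup.
From mathcomp Require Import boolp zify ring.
Import GRing.Theory.
Local Open Scope ring_scope.
Set Implicit Arguments.
Unset Strict Implicit.
Unset Printing Implicit Defensive.

Local Open Scope nat_scope.

(** * Binary trees, enumerated by size *)

Inductive tree : Type := Leaf | Node of tree & tree.

HB.instance Definition _ := gen_eqMixin tree.

Fixpoint tsize t := if t is Node l r then (tsize l + tsize r).+1 else 0.

Fixpoint mirror t := if t is Node l r then Node (mirror r) (mirror l) else Leaf.

Lemma mirrorK : involutive mirror.
Proof. by elim=> //= l -> r ->. Qed.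

Lemma tsize_mirror t : tsize (mirror t) = tsize t.
Proof. by elim: t => //= l -> r ->; rewrite addnC. Qed.

(** Here [h] bounds the height, which makes the recursion structural. Height never exceeds size, so
    filtering [trees_upto n] by size [n] loses no tree. *)
Fixpoint trees_upto h : seq tree :=
  if h is h'.+1 then
    Leaf :: [seq Node l r | l <- trees_upto h', r <- trees_upto h']
  else [:: Leaf].

Lemma trees_upto_uniq h : uniq (trees_upto h).
Proof.
elim: h => //= h IHh; apply/andP; split; first by apply/negP => /allpairsP[p [_ _]].
by apply: allpairs_uniq => // -[l r] [l' r'] _ _ [-> ->].
Qed.

Lemma mem_trees_upto h t : tsize t <= h -> t \in trees_upto h.
Proof.
elim: h t => [|h IHh] [|l r] //= lt_h; rewrite inE ?eqxx //.
by apply/orP; right; apply: (allpairs_f Node); apply: IHh; lia.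
Qed.

Definition trees n := [seq t <- trees_upto n | tsize t == n].

Lemma trees_uniq n : uniq (trees n).
Proof. exact/filter_uniq/trees_upto_uniq. Qed.

Lemma mem_trees n t : (t \in trees n) = (tsize t == n).
Proof.
rewrite mem_filter; case: eqP => //= <-.
by rewrite mem_trees_upto.
Qed.

Lemma big_trees_upto (V : nmodType) (u : tree -> V) n h : n <= h ->
  (\sum_(t <- trees_upto h | tsize t == n) u t = \sum_(t <- trees n) u t)%R.
Proof.
move=> le_nh; rewrite -big_filter; apply: perm_big; apply: uniq_perm.
- exact/filter_uniq/trees_upto_uniq.
- exact: trees_uniq.
move=> t; rewrite mem_trees mem_filter; case: eqP => //= tn.
by rewrite mem_trees_upto ?tn.
Qed.

(** * The word of a tree *)

(* The subtree [l] carries larger values than [r], and the root the largest. *)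
Fixpoint tword o t : seq nat :=
  if t is Node l r then
    tword (o + tsize r) l ++ o + (tsize l + tsize r) :: tword o r
  else [::].

Lemma size_tword o t : size (tword o t) = tsize t.
Proof. by elim: t o => //= l IHl r IHr o; rewrite size_cat /= IHl IHr addnS. Qed.

Lemma tword_perm o t : perm_eq (tword o t) (iota o (tsize t)).
Proof.
elim: t o => //= l IHl r IHr o.
have -> : o :: iota o.+1 (tsize l + tsize r) = iota o (tsize r + tsize l + 1).
  by rewrite addn1 [tsize r + _]addnC.
rewrite !iotaD -catA -cat_rcons perm_catC; apply: perm_cat => //.
by rewrite -cats1 [tsize l + _]addnC; apply: perm_cat.
Qed.


Lemma mem_tword o t x : (x \in tword o t) = (o <= x < o + tsize t).
Proof. by rewrite (perm_mem (tword_perm o t)) mem_iota. Qed.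

(** Equal lengths force equal root values; this value occurs only once in each word, so both words
    split at the same place. *)
Lemma tword_inj o : injective (tword o).
Proof.
move=> t t'; elim: t t' o => [|l IHl r IHr] [|l' r'] o E.
- by [].
- by move: (congr1 size E); rewrite !size_tword.
- by move: (congr1 size E); rewrite !size_tword.
have := congr1 size E; rewrite !size_tword /= => -[eq_sz].
move/eqP: E => /=; rewrite eq_sz eqseq_pivot2l; first last.
- by rewrite mem_tword; lia.
- by rewrite mem_tword; lia.
case/andP=> /eqP El /eqP Er.
have sr : tsize r = tsize r' by rewrite -(size_tword o r) Er size_tword.
by rewrite (IHr _ _ Er); rewrite sr in El; rewrite (IHl _ _ El).
Qed.

(** * Avoidance of 1-3-2 in words, and its decomposition at the maximum *)

Fixpoint avoids132_seq (s : seq nat) : bool :=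
  if s is x :: s' then
    pairwise (fun y z => ~~ (x < z < y)) s' && avoids132_seq s'
  else true.

Lemma avoids132_seqP (s : seq nat) :
  reflect (forall a b c, a < b -> b < c -> c < size s ->
             ~~ (nth 0 s a < nth 0 s c < nth 0 s b))
          (avoids132_seq s).
Proof.
elim: s => [|x s IHs] /=; first by apply: ReflectT.
apply: (iffP andP) => [[/(pairwiseP 0) pw /IHs av] [|a] [|b] [|c] //= | av].
- by rewrite !ltnS => _ lt_bc lt_c; apply: pw => //; rewrite inE ?(ltn_trans lt_bc).
- by rewrite !ltnS; apply: av.
split.
  by apply/(pairwiseP 0) => b c; rewrite !inE => _ lt_c lt_bc; apply: (av 0 b.+1 c.+1).
by apply/IHs => a b c; apply: (av a.+1 b.+1 c.+1).
Qed.

(** In a forbidden triple [m] can only be the middle entry, and such triples are absent exactly when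
    [l] lies above [r]. This also rules out every other triple meeting both sides, as its first
    entry in [l] would be smaller than its last in [r]. *)
Lemma avoids132_pivot m l r : {in l ++ r, forall x, x < m} ->
  (forall x, x \in l -> x \notin r) ->
  avoids132_seq (l ++ m :: r) =
  [&& avoids132_seq l, avoids132_seq r & allrel gtn l r].
Proof.
elim: l => [|x l IHl] /= lt_m dis.
  rewrite andbT; apply: andb_idl => _; apply/(pairwiseP 0) => b c _ /= lt_c _.
  by have /= := lt_m _ (mem_nth 0 lt_c); lia.
rewrite IHl; first last.
- by move=> y y_l; apply: dis; rewrite inE y_l orbT.
- by move=> y y_in; apply: lt_m; rewrite inE y_in orbT.
rewrite pairwise_cat allrel_consl /=.
have lt_x : x < m by apply: lt_m; rewrite inE eqxx.
have ltl y : y \in l -> y < m.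
  by move=> y_l; apply: lt_m; rewrite inE mem_cat y_l !orbT.
have ltr y : y \in r -> y < m.
  by move=> y_r; apply: lt_m; rewrite inE mem_cat y_r !orbT.
have -> : all (fun z => ~~ (x < z < m)) r = all (gtn x) r.
  apply: eq_in_all => z z_r /=; have := ltr _ z_r.
  have : x != z by apply: contraTneq z_r => <-; apply: dis; rewrite inE eqxx.
  by lia.
have [/allP gt_x|] := boolP (all (gtn x) r); last by rewrite /= !andbF.
have -> : allrel (fun y z => ~~ (x < z < y)) l (m :: r).
  apply/allrelP => y z /ltl lt_y; rewrite inE => /predU1P[->|/gt_x /=]; lia.
have -> : pairwise (fun y z => ~~ (x < z < y)) r.
  by apply/(pairwiseP 0) => b c _ lt_c _; have /= := gt_x _ (mem_nth 0 lt_c); lia.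
by rewrite /= andbT andbA.
Qed.

Lemma tword_avoids132 o t : avoids132_seq (tword o t).
Proof.
elim: t o => //= l IHl r IHr o; rewrite avoids132_pivot.
- rewrite IHl IHr; apply/allrelP => x y; rewrite !mem_tword /=; lia.
- by move=> x; rewrite mem_cat !mem_tword; lia.
- by move=> x; rewrite !mem_tword; lia.
Qed.

(** Sorting the two blocks separately and putting that of [r] first gives an increasing list, hence
    the interval itself, which is then cut at [size r]. *)
Lemma perm_cat_iota o l r : allrel gtn l r ->
  perm_eq (l ++ r) (iota o (size l + size r)) ->
  perm_eq r (iota o (size r)) /\ perm_eq l (iota (o + size r) (size l)).
Proof.
move=> gt_lr pe.
have : sort leq r ++ sort leq l = iota o (size r) ++ iota (o + size r) (size l).
  rewrite -iotaD; apply: (sorted_eq leq_trans anti_leq).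
  - rewrite (sorted_pairwise leq_trans) pairwise_cat.
    rewrite -!(sorted_pairwise leq_trans) !sort_sorted ?andbT; try exact: leq_total.
    apply/allrelP => x y; rewrite !mem_sort => xr yl.
    by apply: ltnW; apply: (allrelP gt_lr).
  - exact: iota_sorted.
  rewrite addnC; apply: perm_trans pe; rewrite perm_catC.
  by apply: perm_cat; rewrite perm_sort.
move/eqP; rewrite eqseq_cat ?size_sort ?size_iota // => /andP[/eqP <- /eqP <-].
by rewrite !(perm_sym _ (sort _ _)) !perm_sort.
Qed.

(** Strong induction, cutting at the maximum: each side is again an avoiding arrangement of an
    interval, which is why the offset [o] is kept general. *)
Lemma avoids132_tword o n s : perm_eq s (iota o n) -> avoids132_seq s ->
  exists2 t, tsize t = n & tword o t = s.
Proof.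
elim/ltn_ind: n o s => -[|n] IHn o s pe av.
  by exists Leaf => //; move/perm_size: pe => /size0nil ->.
have m_s : o + n \in s by rewrite (perm_mem pe) mem_iota; lia.
case/splitPr: m_s pe av => l r pe av.
have {}pe : perm_eq (l ++ r) (iota o n).
  move: pe; rewrite -addn1 iotaD cats1 -cat_rcons perm_sym perm_rcons perm_sym.
  by rewrite -cats1 -catA perm_catCA perm_cons.
have us : uniq (l ++ r) by rewrite (perm_uniq pe) iota_uniq.
move: av; rewrite avoids132_pivot; first last.
- by move=> x xl; move: us; rewrite cat_uniq => /and3P[_ /hasPn h _];
    apply: contraL xl => /h.
- by move=> x; rewrite (perm_mem pe) mem_iota; lia.
case/and3P=> avl avr gt_lr.
have szn : size l + size r = n by rewrite -size_cat (perm_size pe) size_iota.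
rewrite -szn in pe; have [pr pl] := perm_cat_iota gt_lr pe.
have [tl sl wl] : exists2 t, tsize t = size l & tword (o + size r) t = l.
  by apply: IHn => //; lia.
have [tr sr wr] : exists2 t, tsize t = size r & tword o t = r.
  by apply: IHn => //; lia.
by exists (Node tl tr); rewrite /= sl sr ?szn // wl wr.
Qed.

(** * From permutations to words and trees *)

Lemma size_word n (pi : 'S_n) : size (word pi) = n.
Proof. by rewrite size_map size_enum_ord. Qed.

Lemma nth_word n (pi : 'S_n) (i : 'I_n) : nth 0 (word pi) i = pi i.
Proof. by rewrite (nth_map i) ?size_enum_ord // nth_ord_enum. Qed.

Lemma word_inj n : injective (@word n).
Proof. by move=> p q E; apply/permP => i; apply: val_inj; rewrite /= -!nth_word E. Qed.

Lemma word_perm n (pi : 'S_n) : perm_eq (word pi) (iota 0 n).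
Proof.
apply: uniq_perm; rewrite ?iota_uniq //.
  by rewrite map_inj_uniq ?enum_uniq // => i j /val_inj /perm_inj.
move=> x; rewrite mem_iota /= add0n; apply/mapP/idP => [[i _ ->]|lt_x].
  exact: ltn_ord.
by exists (pi^-1%g (Ordinal lt_x)); rewrite ?mem_enum ?permKV.
Qed.

Lemma perm_word n s : perm_eq s (iota 0 n) -> exists pi : 'S_n, word pi = s.
Proof.
move=> pe; have sz : size s = n by rewrite (perm_size pe) size_iota.
have lt_n (i : 'I_n) : nth 0 s i < n.
  by have : nth 0 s i \in s; [rewrite mem_nth ?sz|rewrite (perm_mem pe) mem_iota].
pose f i := Ordinal (lt_n i).
have f_inj : injective f.
  move=> i j /(congr1 val) /= /eqP; rewrite nth_uniq ?sz //.
    by move/eqP/val_inj.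
  by rewrite (perm_uniq pe) iota_uniq.
exists (perm f_inj); apply: (@eq_from_nth _ 0); rewrite size_word // => i lt_i.
by rewrite (nth_word _ (Ordinal lt_i)) permE.
Qed.

Lemma avoids132_word n (pi : 'S_n) : avoids132 pi = avoids132_seq (word pi).
Proof.
apply/idP/avoids132_seqP => [av a b c ab bc|av].
  rewrite size_word => cn; have bn := ltn_trans bc cn; have an := ltn_trans ab bn.
  apply: contraNN av => /andP[ac cb].
  apply/existsP; exists (Ordinal an); apply/existsP; exists (Ordinal bn).
  apply/existsP; exists (Ordinal cn) => /=.
  by rewrite ab bc -!nth_word /= ac.
apply/negP => /existsP[a /existsP[b /existsP[c /and4P[ab bc ac cb]]]].
have := av a b c ab bc; rewrite size_word ltn_ord !nth_word ac cb.
by move/(_ isT).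
Qed.

(** The bijection with trees, in a form that reindexes sums over avoiders. *)
Lemma word_avoiders n :
  perm_eq [seq word pi | pi <- enum [pred pi : 'S_n | avoids132 pi]]
          [seq tword 0 t | t <- trees n].
Proof.
apply: uniq_perm.
- by rewrite map_inj_uniq ?enum_uniq //; apply: word_inj.
- by rewrite map_inj_uniq ?trees_uniq //; apply: tword_inj.
move=> s; apply/mapP/mapP => [[pi]|[t]].
  rewrite mem_enum inE avoids132_word => av ->.
  have [t tn wt] := avoids132_tword (word_perm pi) av.
  by exists t; rewrite ?mem_trees ?tn.
rewrite mem_trees => /eqP tn ->; have := tword_perm 0 t; rewrite tn.
case/perm_word => pi wpi; exists pi => //.
by rewrite mem_enum inE avoids132_word wpi tword_avoids132.
Qed.

(** * Occurrences and first runs *)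

Fixpoint occ_seq (e : rel nat) k (s : seq nat) : nat :=
  if s is _ :: s' then ((k <= size s) && sorted e (take k s)) + occ_seq e k s'
  else 0.

Lemma occ_seqE e k s :
  occ_seq e k s =
  \sum_(0 <= i < size s | i + k <= size s) sorted e (take k (drop i s)).
Proof.
elim: s => [|x s IHs]; first by rewrite big_geq.
rewrite [LHS]/= IHs big_mkcond [RHS]big_mkcond /= big_nat_recl //=.
by case: leqP.
Qed.

Lemma occ_word e k n (pi : 'S_n) : occ e k pi = occ_seq e k (word pi).
Proof.
rewrite occ_seqE size_word big_mkord /occ -sum1dep_card [LHS]big_mkcondr /=.
by apply: eq_bigr => i _; case: (sorted _ _).
Qed.

Lemma occ_seq_rev e k s : 0 < k ->
  occ_seq e k (rev s) = occ_seq (fun x y => e y x) k s.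
Proof.
move=> k_gt0; rewrite !occ_seqE size_rev.
(* For [k > 0] the positions with room for a window form this unconditional range, which
   [big_nat_rev] can reverse. *)
have E F : \sum_(0 <= i < size s | i + k <= size s) F i =
           \sum_(0 <= i < (size s).+1 - k) F i.
  rewrite (big_cat_nat (n := (size s).+1 - k)) //=; last by lia.
  rewrite [X in _ + X = _]big_nat_cond.
  rewrite [X in _ + X = _]big1 ?addn0 => [|i]; last by lia.
  rewrite big_nat_cond [RHS]big_nat_cond.
  by apply: eq_bigl => i; lia.
rewrite !E big_nat_rev /=; apply: eq_big_nat => i lt_i; congr (nat_of_bool _).
rewrite -rev_sorted drop_rev take_rev size_take_min revK.
have -> : minn (size s - (0 + ((size s).+1 - k) - i.+1)) (size s) = i + k by lia.
rewrite take_drop; congr (sorted _ (drop _ (take _ _))); lia.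
Qed.

Fixpoint desc_run (s : seq nat) : nat :=
  if s is x :: s' then
    if s' is y :: _ then if y < x then (desc_run s').+1 else 1 else 1
  else 0.

Lemma sorted_take_desc_run k s :
  (k <= size s) && sorted gtn (take k s) = (k <= desc_run s).
Proof.
elim: s k => [|x s IHs] [|k] //=.
have := IHs k; case: s {IHs} => [|y s] /=; first by case: k.
case: k => [|k] /=; first by case: ifP.
by case: (ltnP y x) => _ /=; [rewrite !ltnS | rewrite andbF].
Qed.

Lemma occ_seq_cons k x s :
  occ_seq gtn k (x :: s) = (k <= desc_run (x :: s)) + occ_seq gtn k s.
Proof. by rewrite -sorted_take_desc_run. Qed.

(** The ascent into [m] ends any run before it, so the first run contains [m] only when [l] is
    empty. *)
Lemma desc_run_pivot m l r : {in l ++ r, forall x, x < m} ->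
  desc_run (l ++ m :: r) = if l is [::] then (desc_run r).+1 else desc_run l.
Proof.
elim: l => [|x l IHl] lt_m /=.
  by case: r lt_m => //= y r -> //; rewrite inE eqxx.
have {}IHl := IHl (fun y yl => lt_m y (@mem_behead _ ((x :: l) ++ r) y yl)).
have {lt_m}: x < m by apply: lt_m; rewrite inE eqxx.
by case: l IHl => [|y l] /=; [case: ltngtP | move=> ->].
Qed.

(** An occurrence through [m] must start at [m], since the entry before it is smaller, and it
    continues along the first run of [r]. *)
Lemma occ_seq_pivot k m l r : {in l ++ r, forall x, x < m} ->
  occ_seq gtn k (l ++ m :: r) =
  occ_seq gtn k l + occ_seq gtn k r + (k <= (desc_run r).+1).
Proof.
elim: l => [|x l IHl] lt_m.
  by rewrite cat0s occ_seq_cons (@desc_run_pivot m [::]) // addnC.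
have {}IHl := IHl (fun y yl => lt_m y (@mem_behead _ ((x :: l) ++ r) y yl)).
by rewrite cat_cons !occ_seq_cons IHl (@desc_run_pivot m (x :: l)) // !addnA.
Qed.

Fixpoint run t :=
  if t is Node l r then if l is Leaf then (run r).+1 else run l else 0.

Lemma run_gt0 l r : 0 < run (Node l r).
Proof. by elim: l r => [|l IHl l' _] r //=; apply: IHl. Qed.

Lemma run_eq0 t : (run t == 0) = (t == Leaf).
Proof.
case: t => [|l r]; first by rewrite !eqxx.
by rewrite eqn0Ngt run_gt0; apply/esym/eqP.
Qed.

Fixpoint runs k t :=
  if t is Node l r then runs k l + runs k r + (k <= (run r).+1) else 0.

Lemma desc_run_tword o t : desc_run (tword o t) = run t.
Proof.
elim: t o => //= l IHl r IHr o.
rewrite desc_run_pivot ?IHr ?IHl //; last first.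
  by move=> x; rewrite mem_cat !mem_tword; lia.
(* Comparing sizes matches the two case distinctions: a word is empty exactly when its tree is a
   leaf. *)
have := size_tword (o + tsize r) l.
by case: (tword _ l) => [|? ?]; case: (l).
Qed.

Lemma occ_dec_tword k o t : occ_seq gtn k (tword o t) = runs k t.
Proof.
elim: t o => //= l IHl r IHr o.
rewrite occ_seq_pivot ?IHr ?IHl ?desc_run_tword //.
by move=> x; rewrite mem_cat !mem_tword; lia.
Qed.

(** The pivot lemmas ask only that [m] be the maximum, whatever the order between the two sides, so
    they apply to the reversed word; its sides are swapped, hence the mirror. *)
Lemma desc_run_rev_tword o t : desc_run (rev (tword o t)) = run (mirror t).
Proof.
elim: t o => //= l IHl r IHr o.
rewrite rev_cat rev_cons cat_rcons desc_run_pivot; last first.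
  by move=> x; rewrite mem_cat !mem_rev !mem_tword; lia.
rewrite IHl IHr; have := size_tword o r; rewrite -size_rev -tsize_mirror.
by case: (rev (tword o r)) => [|? ?]; case: (mirror r).
Qed.

Lemma occ_inc_tword k o t : 0 < k ->
  occ_seq ltn k (tword o t) = runs k (mirror t).
Proof.
move=> k_gt0; rewrite -(revK (tword o t)) occ_seq_rev //.
elim: t o => //= l IHl r IHr o.
rewrite rev_cat rev_cons cat_rcons occ_seq_pivot; last first.
  by move=> x; rewrite mem_cat !mem_rev !mem_tword; lia.
by rewrite IHl IHr desc_run_rev_tword.
Qed.

(** * Generating series over trees *)

Local Open Scope ring_scope.

Definition tree_gf (u : tree -> {poly int}) : fps {poly int} :=
  Fps (fun n => \sum_(t <- trees n) u t).

Lemma eq_tree_gf u v : u =1 v -> tree_gf u = tree_gf v.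
Proof. by move=> uv; apply/fpsP => n /=; apply: eq_bigr. Qed.

Lemma tree_gfD u v : tree_gf (fun t => u t + v t) = tree_gf u + tree_gf v.
Proof. by apply/fpsP => n; rewrite fcoefD /= big_split. Qed.

Lemma tree_gf_yM u : tree_gf (fun t => 'X * u t) = y_var * tree_gf u.
Proof.
apply/fpsP => n; rewrite fcoefM big_ord_recl /= subn0 mulr_sumr.
by rewrite [X in _ + X]big1 ?addr0 // => i _; rewrite mul0r.
Qed.

Lemma fcoef_xM (f : fps {poly int}) n :
  fcoef (x_var * f) n = if n is m.+1 then fcoef f m else 0.
Proof.
rewrite fcoefM; case: n => [|n]; first by rewrite big_ord1 /= mul0r.
rewrite !big_ord_recl /= mul0r add0r mul1r subSS subn0.
by rewrite big1 ?addr0 // => i _; rewrite mul0r.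
Qed.

Lemma tree_gf_leaf : tree_gf (fun t => (t == Leaf)%:R) = 1.
Proof.
apply/fpsP => n; rewrite fcoef1 /= /trees big_filter; case: n => [|n].
  by rewrite big_cons big_nil /= eqxx addr0.
by rewrite big1 // => -[|l r] //= _; case: eqP.
Qed.

Lemma tree_gf_node a b :
  tree_gf (fun t => if t is Node l r then a l * b r else 0) =
  x_var * (tree_gf a * tree_gf b).
Proof.
apply/fpsP => n; rewrite fcoef_xM /= /trees big_filter; case: n => [|n] /=.
  by rewrite big_cons big_nil /= addr0.
rewrite big_cons /= -[RHS]/(fcoef (tree_gf a * tree_gf b) n) fcoefM.
rewrite big_mkcond big_allpairs_dep /=.
(* The inner sum over [i] has one term if [tsize l <= n] and none otherwise; it discards the
   oversized trees of [trees_upto n] and exposes the Cauchy product. *)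
transitivity (\sum_(l <- trees_upto n) \sum_(i < n.+1 | tsize l == i)
   a l * \sum_(r <- trees (n - i)%N) b r).
  apply: eq_bigr => l _; rewrite -big_mkcond /=.
  have [le_n | lt_n] := leqP (tsize l) n; last first.
    rewrite !big_pred0 // => [i|r]; last by apply/eqP; lia.
    by apply/eqP => E; move: lt_n; rewrite E ltnNge -ltnS ltn_ord.
  rewrite (big_pred1 (Ordinal (le_n : (tsize l < n.+1)%N))); last first.
    by move=> i; rewrite /= eq_sym.
  rewrite /= -(big_trees_upto b (leq_subr (tsize l) n)) mulr_sumr.
  by apply: eq_bigl => r; apply/eqP/eqP; lia.
rewrite (exchange_big_dep xpredT) //=; apply: eq_bigr => i _.
rewrite big_trees_upto ?mulr_suml // -ltnS //.
Qed.

(** * The functional equation *)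

Section FunctionalEquation.

Variable k : nat.

Let w t : {poly int} := 'X^(runs k t).
Let F := tree_gf w.
Let x := x_var.
Let y := y_var.

(* The extra factor of [v] is the occurrence completed when a parent is put in
   front of the first run of its right subtree. *)
Let v t : {poly int} := w t * 'X^(k <= (run t).+1).
Let E := tree_gf v.
(** With [p] equality to [m] this is the series $D_m$; with [p] the bound [leq m] it is the tail of
    all longer or equal first runs. *)
Let H (p : pred nat) := tree_gf (fun t => w t *+ p (run t)).

Lemma w_node l r : w (Node l r) = w l * v r.
Proof. by rewrite /v /w /= !exprD mulrA. Qed.

Lemma F_eq : F = 1 + x * (F * E).
Proof.
rewrite -tree_gf_leaf -tree_gf_node -tree_gfD; apply: eq_tree_gf => -[|l r].
  by rewrite eqxx addr0 /w expr0.
by rewrite w_node; case: eqP => // _; rewrite add0r.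
Qed.

(** This is what eliminates [E]: dividing by [1 - x * E] is multiplying by [F]. *)
Lemma F_inv : F * (1 - x * E) = 1.
Proof. by rewrite mulrBr mulr1 {1}F_eq; ring. Qed.

(* The first run of a node is that of its left subtree, unless the latter is a
   leaf, in which case the root prolongs the first run of the right subtree. *)
Lemma H_rec (p : pred nat) : p 0%N = false ->
  H p = x * F * tree_gf (fun t => v t *+ p (run t).+1).
Proof.
move=> p0; set G := tree_gf _.
have HE : H p = x * (H p * E) + x * G.
  rewrite -[in X in _ + X](mul1r G) -tree_gf_leaf -!tree_gf_node -tree_gfD.
  apply: eq_tree_gf => -[|l r]; first by rewrite /= p0 addr0.
  rewrite w_node /=; case: l => [|l l'] /=.
    by rewrite eqxx p0 mul0r add0r mul1r /w mul1r.
  have /negPf-> : Node l l' != Leaf by apply/eqP.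
  by rewrite mul0r addr0 mulrnAl.
have {}HE : (1 - x * E) * H p = x * G by rewrite mulrBl mul1r {1}HE; ring.
by rewrite -[LHS]mul1r -F_inv -mulrA HE; ring.
Qed.

(** Only the leaf has an empty first run, which gives 1. Below length [k] no prolongation completes
    an occurrence, so each one contributes just [x * F]. *)
Lemma H_eq m : (m < k)%N -> H (eq_op^~ m) = (x * F) ^+ m.
Proof.
elim: m => [_|m IHm lt_mk].
  rewrite expr0 -tree_gf_leaf; apply: eq_tree_gf => t; rewrite run_eq0.
  by case: eqP => [->|_]; rewrite ?mulr0n // /w expr0.
rewrite H_rec // exprS -IHm ?(ltnW lt_mk) //; congr (_ * _).
apply: eq_tree_gf => t; rewrite /v eqSS; case: eqP => [->|//].
by rewrite leqNgt lt_mk mulr1.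
Qed.

(** From length [k.-1] on, every prolongation contributes [x * y * F]: the tail is a geometric
    series. *)
Lemma H_ge : (1 < k)%N -> H (leq k.-1) * (1 - x * y * F) = (x * F) ^+ k.-1.
Proof.
move=> k_gt1; rewrite -H_eq; last by lia.
have HD : H (leq k.-1) = H (eq_op^~ k.-1) + H (leq k).
  rewrite -tree_gfD; apply: eq_tree_gf => t; rewrite -mulrnDr; congr (_ *+ _); lia.
(* Shifting the bound [k] by one leaves the runs of length at least [k.-1], exactly those for which
   [v] has its extra factor ['X]. *)
have HS : H (leq k) = x * F * (y * H (leq k.-1)).
  rewrite H_rec; last by apply/negbTE; lia.
  rewrite -tree_gf_yM; congr (_ * _); apply: eq_tree_gf => t; rewrite /v.
  rewrite (_ : (k.-1 <= run t) = (k <= (run t).+1))%N; last by lia.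
  case: leqP => _; rewrite ?mulr0 //.
  by rewrite !mulr1n expr1 mulrC.
by rewrite {1}mulrBr mulr1 {1}HD HS; ring.
Qed.

Lemma F_sum m : F = \sum_(0 <= n < m) H (eq_op^~ n) + H (leq m).
Proof.
elim: m => [|m IHm]; first by rewrite big_geq // add0r.
rewrite big_nat_recr //= -addrA -tree_gfD {1}IHm; congr (_ + _).
apply: eq_tree_gf => t; rewrite -mulrnDr; congr (_ *+ _); lia.
Qed.

Lemma tree_gf_runs_eq : (1 < k)%N ->
  F = \sum_(0 <= n < k.-1) x ^+ n * F ^+ n
      + x ^+ k.-1 * F ^+ k.-1 / (1 - x * y * F).
Proof.
move=> k_gt1; rewrite -exprMn -H_ge // mulrK ?unit_1BxyF //.
rewrite {1}(F_sum k.-1); congr (_ + _); apply: eq_big_nat => n lt_n.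
by rewrite -exprMn H_eq //; lia.
Qed.

End FunctionalEquation.

(** * Transfer to permutations and conclusion *)

Lemma genfun132_trees e k (s : tree -> nat) :
  (forall t, occ_seq e k (tword 0 t) = s t) ->
  genfun132 e k = tree_gf (fun t => 'X^(s t)).
Proof.
move=> eq_s; apply/fpsP => n.
(* Collecting the avoiders by number of occurrences: the coefficient of ['X^r] in this sum counts
   those with exactly [r]. *)
transitivity (\sum_(pi : 'S_n | avoids132 pi) 'X^(occ e k pi) : {poly int}).
  apply/polyP => r; rewrite coef_genfun132 coef_sum /count132 -sum1dep_card.
  rewrite natr_sum big_mkcondr; apply: eq_bigr => pi _.
  by rewrite coefXn eq_sym; case: eqP.
transitivity (\sum_(w <- [seq word pi | pi <- enum [pred pi : 'S_n | avoids132 pi]])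
                'X^(occ_seq e k w) : {poly int}).
  by rewrite big_map big_enum; apply: eq_bigr => pi _; rewrite occ_word.
rewrite (perm_big _ (word_avoiders n)) big_map /=.
by apply: eq_bigr => t _; rewrite eq_s.
Qed.

Lemma tree_gf_mirror u : tree_gf (u \o mirror) = tree_gf u.
Proof.
apply/fpsP => n /=; rewrite -(big_map mirror xpredT u); apply: perm_big.
apply: uniq_perm; rewrite ?(map_inj_uniq (can_inj mirrorK)) ?trees_uniq //.
move=> t; rewrite -{1}(mirrorK t) (mem_map (can_inj mirrorK)) !mem_trees.
by rewrite tsize_mirror.
Qed.

Theorem theorem2p20 (k : nat) (hk : (2 <= k)%N) :
  F_dec k = F_inc k /\
  let x := x_var in
  let y := y_var in
  let F := F_inc k in
  F = \sum_(0 <= n < k.-1) x ^+ n * F ^+ n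
      + x ^+ k.-1 * F ^+ k.-1 / (1 - x * y * F).
Proof.
have dec : F_dec k = tree_gf (fun t => 'X^(runs k t)).
  exact/genfun132_trees/occ_dec_tword.
have inc : F_inc k = tree_gf (fun t => 'X^(runs k t)).
  (* Mirroring leaves the series unchanged and turns [runs k] into the statistic of increasing
     occurrences. *)
  rewrite -tree_gf_mirror; apply: genfun132_trees => t.
  exact/occ_inc_tword/ltnW.
by rewrite dec inc; split => //; apply: tree_gf_runs_eq.
Qed.
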